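(* The logic $\mathsf{iSL}_\Box$ is decidable; that is, there is an algorithm which, given a formula $\varphi$, decides whether $\varphi$ is a theorem of $\mathsf{iSL}_\Box$.
   Context: Formulas are built from the constant $\bot$, atoms (propositional variables), binary connectives $\wedge,\vee,\to$ and the unary modal operator $\Box$ (there is no $\Diamond$); $\neg\varphi$ abbreviates $\varphi\to\bot$. The logic $\mathsf{iK}_\Box$ is given by a standard Hilbert system for intuitionistic propositional logic (in the modal language, with modus ponens) extended by the axiom scheme $\Box(\varphi\to\psi)\to(\Box\varphi\to\Box\psi)$ and the necessitation rule (from $\vdash\varphi$ infer $\vdash\Box\varphi$). The logic $\mathsf{iSL}_\Box$ (intuitionistic strong Löb logic) is $\mathsf{iK}_\Box$ extended by the Strong Löb Principle, the axiom scheme $(\Box\varphi\to\varphi)\to\varphi$. *)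

(* Defs.v *)
From Stdlib Require Import List.

(** * Modal formulas and the logics iK and iSL *)

Inductive form : Type :=
| Bot : form
| Atom : nat -> form
| And : form -> form -> form
| Or : form -> form -> form
| Imp : form -> form -> form
| Box : form -> form.

Declare Scope form_scope.
Delimit Scope form_scope with form.
Bind Scope form_scope with form.
Infix "/\" := And : form_scope.
Infix "\/" := Or : form_scope.
Notation "A --> B" := (Imp A B) (at level 90, right associativity) : form_scope.

Inductive ipl_axiom : form -> Prop :=
| ax_k A B : ipl_axiom (A --> B --> A)
| ax_s A B C : ipl_axiom ((A --> B --> C) --> (A --> B) --> A --> C)
| ax_and_l A B : ipl_axiom (A /\ B --> A)
| ax_and_r A B : ipl_axiom (A /\ B --> B)
| ax_and_i A B : ipl_axiom (A --> B --> A /\ B)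
| ax_or_l A B : ipl_axiom (A --> A \/ B)
| ax_or_r A B : ipl_axiom (B --> A \/ B)
| ax_or_e A B C : ipl_axiom ((A --> C) --> (B --> C) --> A \/ B --> C)
| ax_bot A : ipl_axiom (Bot --> A).

(** Theoremhood in the extension of iK by the axioms [Ax]; necessitation applies
    to theorems only, as there are no assumptions. *)
Inductive iK_ext (Ax : form -> Prop) : form -> Prop :=
| iK_ipl A : ipl_axiom A -> iK_ext Ax A
| iK_K A B : iK_ext Ax (Box (A --> B) --> Box A --> Box B)
| iK_Ax A : Ax A -> iK_ext Ax A
| iK_mp A B : iK_ext Ax (A --> B) -> iK_ext Ax A -> iK_ext Ax B
| iK_nec A : iK_ext Ax A -> iK_ext Ax (Box A).

Definition iK : form -> Prop := iK_ext (fun _ => False).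

Inductive strong_loeb : form -> Prop :=
| ax_SL A : strong_loeb ((Box A --> A) --> A).

Definition iSL : form -> Prop := iK_ext strong_loeb.

(** * Algorithms *)

(** A predicate [P] on formulas always has a Boolean characteristic function once
    excluded middle and choice are assumed, so decidability is stated for an
    explicit model of computation: first-order recursive programs over binary
    trees (pure Lisp over S-expressions with the single atom [Leaf]; the language
    F of N. D. Jones, "Computability and Complexity from a Programming
    Perspective", with several function definitions).  It is Turing complete. *)

Inductive tree : Type :=
| Leaf : tree
| Node : tree -> tree -> tree.

Inductive expr : Type :=
| EVar : expr
| ELeaf : expr
| ENode : expr -> expr -> expr
| EFst : expr -> expr
| ESnd : expr -> expr
| EIf : expr -> expr -> expr -> expr
| ECall : nat -> expr -> expr.

(** A program is a finite list of mutually recursive unary functions: entry [i]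
    is the body of function [i], in which [EVar] is the argument. *)
Definition program : Type := list expr.

Definition tree_fst (t : tree) : tree :=
  match t with Leaf => Leaf | Node a _ => a end.
Definition tree_snd (t : tree) : tree :=
  match t with Leaf => Leaf | Node _ b => b end.

(** [eval p x e v]: with argument [x], the call-by-value evaluation of [e]
    terminates with value [v].  In conditionals [Leaf] is false and every [Node]
    is true, and only the selected branch is evaluated. *)
Inductive eval (p : program) (x : tree) : expr -> tree -> Prop :=
| eval_var : eval p x EVar x
| eval_leaf : eval p x ELeaf Leaf
| eval_node e1 e2 v1 v2 :
    eval p x e1 v1 -> eval p x e2 v2 -> eval p x (ENode e1 e2) (Node v1 v2)
| eval_fst e v : eval p x e v -> eval p x (EFst e) (tree_fst v)
| eval_snd e v : eval p x e v -> eval p x (ESnd e) (tree_snd v)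
| eval_if_true e e1 e2 a b v :
    eval p x e (Node a b) -> eval p x e1 v -> eval p x (EIf e e1 e2) v
| eval_if_false e e1 e2 v :
    eval p x e Leaf -> eval p x e2 v -> eval p x (EIf e e1 e2) v
| eval_call i e a body v :
    eval p x e a -> nth_error p i = Some body -> eval p a body v ->
    eval p x (ECall i e) v.

(** Running a program means calling its function [0]. *)
Definition computes (p : program) (input output : tree) : Prop :=
  eval p input (ECall 0 EVar) output.

Lemma eval_det p x e v w : eval p x e v -> eval p x e w -> v = w.
Proof.
  intros H; revert w; induction H; intros w Hw; inversion Hw; subst;
    repeat match goal with
      | IH : forall w, eval ?p ?x ?e w -> _ = w, H : eval ?p ?x ?e _ |- _ =>
          apply IH in H; subst
      end; try reflexivity; try discriminate.
  match goal with
  | H1 : nth_error p i = Some _, H2 : nth_error p i = Some _ |- _ =>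
      rewrite H1 in H2; injection H2 as ->
  end.
  auto.
Qed.

Corollary computes_det p x v w : computes p x v -> computes p x w -> v = w.
Proof. apply eval_det. Qed.

Definition bool_tree (b : bool) : tree := if b then Node Leaf Leaf else Leaf.

Fixpoint nat_tree (n : nat) : tree :=
  match n with 0 => Leaf | S m => Node Leaf (nat_tree m) end.

Fixpoint form_tree (A : form) : tree :=
  match A with
  | Bot => Node (nat_tree 0) Leaf
  | Atom n => Node (nat_tree 1) (nat_tree n)
  | And B C => Node (nat_tree 2) (Node (form_tree B) (form_tree C))
  | Or B C => Node (nat_tree 3) (Node (form_tree B) (form_tree C))
  | Imp B C => Node (nat_tree 4) (Node (form_tree B) (form_tree C))
  | Box B => Node (nat_tree 5) (form_tree B)
  end.

Lemma nat_tree_inj m n : nat_tree m = nat_tree n -> m = n.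
Proof.
  revert n; induction m; intros [|n] H; try discriminate; auto.
  injection H as H; f_equal; auto.
Qed.

Lemma form_tree_inj A B : form_tree A = form_tree B -> A = B.
Proof.
  revert B; induction A; intros [] H; try discriminate; auto;
    injection H; intros; f_equal; auto using nat_tree_inj.
Qed.

(** One program halts on the code of every formula [A] with a Boolean answer, and
    the answer is [true] exactly when [P A]. *)
Definition decidable (P : form -> Prop) : Prop :=
  exists p : program, forall A : form, exists b : bool,
    computes p (form_tree A) (bool_tree b) /\ (b = true <-> P A).

(* Main.v *)
From Stdlib Require Import List Arith Lia Classical.
Require Import Defs.
Import ListNotations.

(** Let [S] be the set of subformulas of [A].  Call a subset [X] of [S] a world
    when it is coherent for the connectives and every implication or boxed formula
    of [S] missing from [X] is refuted by a world above [X].  Worlds ordered by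
    inclusion, with [X] seeing [Y] when [Y] is strictly larger and contains
    [B] for each [Box B] in [X], form a model of iSL whose truth is membership,
    so a world omitting [A] refutes [A].  Conversely, if [A] is not derivable, then
    some prime theory over [S] omits [A], and every prime theory [X] is a world: if
    [X] does not derive [Box B], then [X], the [C] with [Box C] in [X], and [Box B]
    together do not derive [B], by the strong Loeb principle and [C --> Box C].  The
    witnesses needed by [X] are strictly larger than [X], hence [length S + 1]
    rounds of the inductive definition of worlds are enough. *)

(** * The decision procedure on lists of formulas *)

(** Conjunctions are written with [if], here and below, so that these functions take the same
    branches as their counterparts in the program. *)
Fixpoint tree_eqb (s t : tree) : bool :=
  match s, t with
  | Leaf, Leaf => true
  | Node a b, Node c d => if tree_eqb a c then tree_eqb b d else false
  | _, _ => false
  end.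

Lemma tree_eqb_eq s t : tree_eqb s t = true <-> s = t.
Proof.
  revert t; induction s as [|a IHa b IHb]; intros [|c d]; simpl;
    try (split; congruence).
  specialize (IHa c); specialize (IHb d).
  destruct (tree_eqb a c).
  - destruct IHa as [-> _]; auto. rewrite IHb; split; congruence.
  - split; [discriminate|]. intros [= -> ->]. now apply IHa.
Qed.

(** Formulas are compared through their codes, which are all that the program sees. *)
Definition mem (A : form) (X : list form) : bool :=
  existsb (fun B => tree_eqb (form_tree A) (form_tree B)) X.

Lemma mem_In A X : mem A X = true <-> In A X.
Proof.
  unfold mem; rewrite existsb_exists; split.
  - intros (B & HB & E). apply tree_eqb_eq, form_tree_inj in E. now subst.
  - intros H; exists A; split; auto. now apply tree_eqb_eq.
Qed.

Lemma mem_false A X : mem A X = false <-> ~ In A X.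
Proof. rewrite <- mem_In. now destruct (mem A X). Qed.

Definition subset (X Y : list form) : bool := forallb (fun A => mem A Y) X.

Definition unbox_subset (X Y : list form) : bool :=
  forallb (fun A => match A with Box B => mem B Y | _ => true end) X.

Lemma subset_incl X Y : subset X Y = true <-> incl X Y.
Proof.
  unfold subset; rewrite forallb_forall.
  split; intros H A HA; apply mem_In; auto.
Qed.

Lemma unbox_subset_spec X Y :
  unbox_subset X Y = true <-> forall B, In (Box B) X -> In B Y.
Proof.
  unfold unbox_subset; rewrite forallb_forall; split.
  - intros H B HB. apply mem_In. exact (H _ HB).
  - intros H [] HA; auto. now apply mem_In, H.
Qed.

(** One test serves both kinds of witness: [Z] is empty for an implication and equal to [X] for a
    boxed formula. *)
Definition separates (X Z : list form) (A B : form) (Y : list form) : bool :=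
  if subset X Y then
    if unbox_subset Z Y then
      if mem A Y then negb (mem B Y) else false
    else false
  else false.

Lemma separates_spec X Z A B Y :
  separates X Z A B Y = true <->
  incl X Y /\ (forall C, In (Box C) Z -> In C Y) /\ In A Y /\ ~ In B Y.
Proof.
  unfold separates. rewrite <- subset_incl, <- unbox_subset_spec, <- !mem_In.
  destruct (subset X Y), (unbox_subset Z Y), (mem A Y), (mem B Y); simpl;
    intuition congruence.
Qed.

(** A witness from [G] is sought only where it must be strictly larger than [X]. If [Imp B C] and
    [C] are missing but [B] is present, [X] is its own witness; otherwise the witness gains [B]. A
    witness against [Box B] is required to contain [Box B] itself, which the strong Loeb principle
    makes harmless. *)
Definition locally_ok (G : list (list form)) (X : list form) (A : form) : bool :=
  match A with
  | Bot => negb (mem A X)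
  | Atom _ => true
  | And B C =>
      if mem A X then (if mem B X then mem C X else false)
      else if mem B X then negb (mem C X) else true
  | Or B C =>
      if mem A X then (if mem B X then true else mem C X)
      else if mem B X then false else negb (mem C X)
  | Imp B C =>
      if mem A X then (if mem B X then mem C X else true)
      else if mem B X then negb (mem C X) else existsb (separates X [] B C) G
  | Box B => if mem A X then true else existsb (separates X X A B) G
  end.

(** The accumulators here and in [sublists] spare the program an append function. *)
Fixpoint subforms (A : form) (acc : list form) : list form :=
  A :: match A with
       | Bot | Atom _ => acc
       | And B C | Or B C | Imp B C => subforms B (subforms C acc)
       | Box B => subforms B acc
       end.

Fixpoint sublists (S X : list form) (acc : list (list form)) : list (list form) :=
  match S with
  | [] => X :: acc
  | A :: S' => sublists S' (A :: X) (sublists S' X acc)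
  end.

(* Round [n + 1] collects the sets whose witnesses were found in round [n]. *)
Fixpoint worlds (S : list form) (n : nat) : list (list form) :=
  match n with
  | 0 => []
  | Datatypes.S m =>
      filter (fun X => forallb (locally_ok (worlds S m) X) S) (sublists S [] [])
  end.

Definition iSL_dec (A : form) : bool :=
  let S := subforms A [] in forallb (mem A) (worlds S (Datatypes.S (length S))).

(** * Subsets, subformulas and the measure [deficit] *)

Lemma sublists_acc S X acc Y : In Y acc -> In Y (sublists S X acc).
Proof. revert X acc; induction S; simpl; auto. Qed.

(** Excluded middle decides at each formula which half of the enumeration to follow, so [P] may be
    any predicate. This turns a theory given as a predicate into one of the listed sets. *)
Lemma sublists_complete (P : form -> Prop) S X acc :
  exists Y, In Y (sublists S X acc) /\
    forall A, In A Y <-> In A X \/ (In A S /\ P A).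
Proof.
  revert X acc; induction S as [|B S IH]; simpl; intros X acc.
  - exists X; simpl; intuition.
  - destruct (classic (P B)) as [HB|HB].
    + destruct (IH (B :: X) (sublists S X acc)) as (Y & HY & E).
      exists Y; split; auto. intros A; rewrite E; simpl. intuition (subst; auto).
    + destruct (IH X acc) as (Y & HY & E). exists Y; split.
      * now apply sublists_acc.
      * intros A; rewrite E. intuition (subst; tauto).
Qed.

Lemma subforms_acc A acc : incl acc (subforms A acc).
Proof.
  revert acc; induction A; simpl; intros acc; apply incl_tl;
    eauto using incl_refl, incl_tran.
Qed.

Lemma subforms_self A acc : In A (subforms A acc).
Proof. destruct A; simpl; auto. Qed.

Definition immediate (A : form) : list form :=
  match A with
  | Bot | Atom _ => []
  | And B C | Or B C | Imp B C => [B; C]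
  | Box B => [B]
  end.

Definition subclosed (S : list form) : Prop :=
  forall A, In A S -> incl (immediate A) S.

Lemma subforms_closed A acc : subclosed acc -> subclosed (subforms A acc).
Proof.
  assert (cons : forall B S, subclosed S -> incl (immediate B) S -> subclosed (B :: S)).
  { intros B S HS HB C [<-|HC]; apply incl_tl; auto. }
  revert acc; induction A; simpl; intros acc H; apply cons; auto; simpl;
    intros B HB; simpl in HB; intuition subst;
    solve [apply subforms_self | apply subforms_acc, subforms_self].
Qed.

Lemma filter_length_mono {T} (f g : T -> bool) l :
  (forall x, In x l -> f x = true -> g x = true) ->
  length (filter f l) <= length (filter g l).
Proof.
  induction l as [|x l IH]; simpl; intros H; auto.
  assert (IH' := IH (fun y Hy => H y (or_intror Hy))).
  specialize (H x (or_introl eq_refl)).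
  destruct (f x), (g x); simpl; lia.
Qed.

Lemma filter_length_lt {T} (f g : T -> bool) l y :
  (forall x, In x l -> f x = true -> g x = true) ->
  In y l -> f y = false -> g y = true ->
  length (filter f l) < length (filter g l).
Proof.
  induction l as [|x l IH]; simpl; intros H Hy Hf Hg; [tauto|].
  assert (IH' := IH (fun z Hz => H z (or_intror Hz))).
  assert (M := filter_length_mono f g l (fun z Hz => H z (or_intror Hz))).
  specialize (H x (or_introl eq_refl)).
  destruct Hy as [->|Hy].
  - rewrite Hf, Hg; simpl; lia.
  - specialize (IH' Hy Hf Hg). destruct (f x), (g x); simpl; lia.
Qed.

(** This measure drops along strict extensions inside [S]. It gives both the converse
    well-foundedness of the model and the bound on the number of rounds. *)
Definition deficit (S X : list form) : nat :=
  length (filter (fun A => negb (mem A X)) S).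

Lemma deficit_lt S X Y A :
  incl X Y -> In A S -> In A Y -> ~ In A X -> deficit S Y < deficit S X.
Proof.
  intros XY AS AY AX. apply (filter_length_lt _ _ _ A); auto.
  - intros B _. rewrite !Bool.negb_true_iff, !mem_false. auto.
  - apply Bool.negb_false_iff. now apply mem_In.
  - apply Bool.negb_true_iff. now apply mem_false.
Qed.

(** * Kripke semantics and soundness *)

(** [le_acc] makes boxed formulas persistent; [acc_le] and [acc_wf] together validate the strong
    Loeb principle. *)
Record kripke : Type := {
  world : Type;
  le : world -> world -> Prop;
  acc : world -> world -> Prop;
  val : world -> nat -> Prop;
  le_refl x : le x x;
  le_trans x y z : le x y -> le y z -> le x z;
  le_acc x y z : le x y -> acc y z -> acc x z;
  acc_le x y : acc x y -> le x y;
  acc_wf : well_founded (fun y x => acc x y);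
  val_mono x y n : le x y -> val x n -> val y n }.

Fixpoint forces (K : kripke) (x : world K) (A : form) : Prop :=
  match A with
  | Bot => False
  | Atom n => val K x n
  | And B C => forces K x B /\ forces K x C
  | Or B C => forces K x B \/ forces K x C
  | Imp B C => forall y, le K x y -> forces K y B -> forces K y C
  | Box B => forall y, acc K x y -> forces K y B
  end.

Lemma forces_mono K A x y : le K x y -> forces K x A -> forces K y A.
Proof.
  revert x y; induction A; simpl; intros x y H; intuition eauto using val_mono, le_trans, le_acc.
Qed.

Lemma iSL_sound K A : iSL A -> forall x, forces K x A.
Proof.
  induction 1 as [A HA|A B|A HA|A B _ IH1 _ IH2|A _ IH].
  - destruct HA; simpl; intros; intuition eauto using forces_mono, le_trans, le_refl.
  - simpl. intros x y xy H z yz H' w zw.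
    apply (H w); eauto using le_acc, le_refl.
  - destruct HA as [A]. intros x y _ H.
    (* Induction along [acc]: the successors of [z] lie above [y] again, so they force [A], hence
       [z] forces [Box A] and therefore [A]. *)
    assert (G : forall z, le K y z -> forces K z A).
    { intros z; induction z as [z IH] using (well_founded_induction (acc_wf K)).
      intros yz. apply H; auto. intros w zw.
      apply IH; eauto using le_trans, acc_le. }
    apply G, le_refl.
  - intros x. exact (IH1 x x (le_refl K x) (IH2 x)).
  - intros x y _. auto.
Qed.

(** * The model of worlds *)

Lemma worlds_spec S n X :
  In X (worlds S (Datatypes.S n)) <->
  In X (sublists S [] []) /\ forall A, In A S -> locally_ok (worlds S n) X A = true.
Proof. simpl. now rewrite filter_In, forallb_forall. Qed.

(** Admitting every round makes the witnesses found in the preceding round points of the same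
    model. *)
Definition good (S X : list form) : Prop := exists n, In X (worlds S n).

(** Strictness is expressed by a formula of [S], so that [deficit S] decreases along the step. *)
Definition modal_step (S X Y : list form) : Prop :=
  incl X Y /\ (forall C, In (Box C) X -> In C Y) /\ exists A, In A S /\ In A Y /\ ~ In A X.

Lemma modal_step_wf S : well_founded (fun Y X : {X | good S X} =>
  modal_step S (proj1_sig X) (proj1_sig Y)).
Proof.
  apply (well_founded_lt_compat _ (fun X => deficit S (proj1_sig X))).
  intros X Y (H & _ & A & ? & ? & ?). eapply deficit_lt; eauto.
Qed.

Lemma incl_modal_step S X Y Z : incl X Y -> modal_step S Y Z -> modal_step S X Z.
Proof.
  unfold modal_step, incl. intros XY (YZ & H & A & AS & AZ & AY).
  split; [|split]; auto. exists A; intuition.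
Qed.

Definition worlds_model (S : list form) : kripke := {|
  world := {X | good S X};
  le X Y := incl (proj1_sig X) (proj1_sig Y);
  acc X Y := modal_step S (proj1_sig X) (proj1_sig Y);
  val X n := In (Atom n) (proj1_sig X);
  le_refl X := incl_refl (proj1_sig X);
  le_trans X Y Z := @incl_tran _ (proj1_sig X) (proj1_sig Y) (proj1_sig Z);
  le_acc X Y Z := incl_modal_step S (proj1_sig X) (proj1_sig Y) (proj1_sig Z);
  acc_le X Y H := proj1 H;
  acc_wf := modal_step_wf S;
  val_mono X Y n H := H (Atom n) |}.

Lemma truth S (HS : subclosed S) A (X : {X | good S X}) :
  In A S -> forces (worlds_model S) X A <-> In A (proj1_sig X).
Proof.
  (* Round 0 is empty, so [X] was accepted in a round [n + 1] and its witnesses come from round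
     [n]. *)
  revert X; induction A as [|p|B IHB C IHC|B IHB C IHC|B IHB C IHC|B IHB];
    intros X HA; assert (I := HS _ HA); simpl in I;
    assert (OK := proj2_sig X); destruct OK as [[|n] OK]; try contradiction OK;
    apply worlds_spec in OK; destruct OK as [_ OK]; specialize (OK _ HA);
    unfold locally_ok in OK.
  - simpl. apply Bool.negb_true_iff, mem_false in OK. tauto.
  - reflexivity.
  - simpl. rewrite IHB, IHC by (apply I; simpl; auto).
    rewrite <- !mem_In.
    destruct (mem (And B C)), (mem B), (mem C); simpl in OK; intuition congruence.
  - simpl. rewrite IHB, IHC by (apply I; simpl; auto).
    rewrite <- !mem_In.
    destruct (mem (Or B C)), (mem B), (mem C); simpl in OK; intuition congruence.
  - assert (IB : In B S) by (apply I; simpl; auto).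
    assert (IC : In C S) by (apply I; simpl; auto).
    split; intros H.
    + apply mem_In. destruct (mem (Imp B C)) eqn:E; auto. exfalso.
      destruct (mem B) eqn:EB.
      * apply Bool.negb_true_iff, mem_false in OK. apply mem_In in EB.
        apply OK. apply IHC; auto. apply H; [apply incl_refl|]. now apply IHB.
      * apply existsb_exists in OK. destruct OK as (Y & HY & OK).
        apply separates_spec in OK. destruct OK as (XY & _ & BY & CY).
        pose (Y' := exist (good S) Y (ex_intro _ n HY)).
        apply CY. apply (IHC Y'); auto. apply (H Y'); auto. now apply IHB.
    (* [Imp B C] persists to [Y] by inclusion, and the local check at [Y] itself performs modus
       ponens. *)
    + intros Y XY HB. apply IHC; auto. apply IHB in HB; auto.
      destruct Y as [Y [[|m] HY]]; [contradiction|]. simpl in *.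
      change (In Y (worlds S (Datatypes.S m))) in HY.
      apply worlds_spec in HY. destruct HY as [_ OKY].
      specialize (OKY _ HA). simpl in OKY.
      rewrite (proj2 (mem_In _ _) (XY _ H)), (proj2 (mem_In _ _) HB) in OKY.
      now apply mem_In.
  - assert (IB : In B S) by (apply I; simpl; auto).
    split; intros H.
    + apply mem_In. destruct (mem (Box B)) eqn:E; auto. exfalso.
      apply existsb_exists in OK. destruct OK as (Y & HY & OK).
      apply separates_spec in OK. destruct OK as (XY & BX & BY & CY).
      apply mem_false in E.
      pose (Y' := exist (good S) Y (ex_intro _ n HY)).
      apply CY. apply (IHB Y'); auto. apply (H Y').
      (* [Box B] lies in the witness but not in [X], which makes the step strict. *)
      split; [|split]; auto. exists (Box B); auto.
    + intros Y (XY & BX & _). apply IHB; auto.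
Qed.

(** * Completeness *)

(** Necessitation is available only inside [der_thm], which is why the deduction theorem holds. *)
Inductive der (G : form -> Prop) : form -> Prop :=
| der_hyp A : G A -> der G A
| der_thm A : iSL A -> der G A
| der_mp A B : der G (Imp A B) -> der G A -> der G B.

Definition extend (G : form -> Prop) (A : form) : form -> Prop :=
  fun B => B = A \/ G B.

Lemma der_ipl G A : ipl_axiom A -> der G A.
Proof. intros; now apply der_thm, iK_ipl. Qed.

Lemma der_cut G H A : der G A -> (forall B, G B -> der H B) -> der H A.
Proof. induction 1; eauto using der_thm, der_mp. Qed.

Lemma deduction G A B : der (extend G A) B -> der G (Imp A B).
Proof.
  induction 1 as [B [->|HB]|B HB|B C _ IH1 _ IH2].
  - apply der_mp with (Imp A (Imp A A)); [|apply der_ipl, ax_k].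
    apply der_mp with (Imp A (Imp (Imp A A) A)); apply der_ipl; constructor.
  - eapply der_mp; [apply der_ipl, ax_k|now apply der_hyp].
  - eapply der_mp; [apply der_ipl, ax_k|now apply der_thm].
  - eapply der_mp; [|exact IH2]. eapply der_mp; [|exact IH1].
    apply der_ipl; constructor.
Qed.

Lemma der_cut1 G A B : der G A -> der (extend G A) B -> der G B.
Proof. intros HA HB. exact (der_mp G A B (deduction G A B HB) HA). Qed.

Lemma der_or G A B C :
  der G (Or A B) -> der (extend G A) C -> der (extend G B) C -> der G C.
Proof.
  intros H HA HB. eapply der_mp; [|exact H].
  eapply der_mp; [|exact (deduction G B C HB)].
  eapply der_mp; [|exact (deduction G A C HA)]. apply der_ipl, ax_or_e.
Qed.

Lemma der_empty A : der (fun _ => False) A -> iSL A.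
Proof. induction 1; [tauto|auto|]. eapply iK_mp; eauto. Qed.

Lemma der_loeb G A : der (extend G (Box A)) A -> der G A.
Proof.
  intros H. eapply der_mp; [|apply deduction, H].
  apply der_thm, iK_Ax. constructor.
Qed.

(** The derivation is boxed node by node: theorems by necessitation, modus ponens by the K axiom. *)
Lemma der_box G H A : der G A -> (forall B, G B -> der H (Box B)) -> der H (Box A).
Proof.
  intros D HG. induction D as [B HB|B HB|B C _ IH1 _ IH2]; auto.
  - apply der_thm, iK_nec, HB.
  - eapply der_mp; [|exact IH2]. eapply der_mp; [|exact IH1].
    apply der_thm, iK_K.
Qed.

Lemma der_coreflection G A : der G A -> der G (Box A).
Proof.
  intros HA.
  (* The strong Loeb principle for [And A (Box A)]. *)
  apply der_mp with (And A (Box A)); [apply der_ipl; constructor|].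
  apply der_loeb.
  assert (HA' : der (extend G (Box (And A (Box A)))) A).
  { eapply der_cut; [exact HA|]. intros; apply der_hyp; now right. }
  eapply der_mp; [eapply der_mp; [apply der_ipl, ax_and_i|exact HA']|].
  (* [Box A] comes from boxing the projection of [And A (Box A)] to [A]. *)
  apply der_box with (G := fun B => B = And A (Box A)).
  - eapply der_mp; [apply der_ipl, ax_and_l|]. now apply der_hyp.
  - intros B ->. apply der_hyp; now left.
Qed.

(** * Prime theories *)

(** The formulas of [S] are added one at a time unless [D] would become derivable. A rejected
    formula still yields [D] over the final, larger [H]; closure and primeness both follow from this
    last clause. *)
Lemma lindenbaum S G D : ~ der G D ->
  exists H : form -> Prop, (forall A, G A -> H A) /\ (forall A, H A -> G A \/ In A S) /\
    ~ der H D /\ forall A, In A S -> H A \/ der (extend H A) D.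
Proof.
  revert G; induction S as [|B S IH]; intros G HD.
  - exists G; simpl; intuition.
  - destruct (classic (der (extend G B) D)) as [HB|HB].
    + destruct (IH G HD) as (H & GH & HG & HD' & HS). exists H; simpl.
      repeat split; auto.
      * intros A HA; destruct (HG A HA); auto.
      * intros A [<-|HA]; auto. right. eapply der_cut; [exact HB|].
        intros C [->|HC]; apply der_hyp; [now left|right; auto].
    + destruct (IH (extend G B) HB) as (H & GH & HG & HD' & HS). exists H; simpl.
      repeat split; auto.
      * intros A HA; apply GH; now right.
      * intros A HA; destruct (HG A HA) as [[->|]|]; auto.
      * intros A [<-|HA]; auto. left; apply GH; now left.
Qed.

(** These are the prime theories over [S]. *)
Record saturated (S X : list form) : Prop := {
  sat_closed A : In A S -> der (fun B => In B X) A -> In A X;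
  sat_consistent : ~ der (fun B => In B X) Bot;
  sat_prime A B : In A S -> In B S -> In (Or A B) X -> In A X \/ In B X }.

Lemma saturated_extension S (G : form -> Prop) D :
  (forall A, G A -> In A S) -> ~ der G D ->
  exists X, In X (sublists S [] []) /\ saturated S X /\
    (forall A, G A -> In A X) /\ ~ In D X.
Proof.
  intros GS HD. destruct (lindenbaum S G D HD) as (H & GH & HG & HD' & HS).
  destruct (sublists_complete H S [] []) as (X & HX & E). exists X.
  assert (EX : forall A, In A X <-> H A).
  { intros A; rewrite E; simpl. split; [tauto|].
    intros HA; destruct (HG A HA); auto. }
  assert (DX : forall A, der (fun B => In B X) A -> der H A).
  { intros A HA. eapply der_cut; [exact HA|]. intros; now apply der_hyp, EX. }
  split; [assumption|]; split; [split|split].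
  - intros A AS HA. apply EX. destruct (HS A AS) as [|HA']; auto.
    destruct HD'. eauto using der_cut1.
  - intros HB. apply HD'. eapply der_mp; [apply der_ipl, ax_bot|]. auto.
  - intros A B AS BS HAB. rewrite !EX.
    destruct (HS A AS) as [|HA]; auto. destruct (HS B BS) as [|HB]; auto.
    destruct HD'. eapply der_or; eauto using der_hyp.
  - intros A HA; apply EX; auto.
  - intros HX'. apply HD', der_hyp, EX, HX'.
Qed.

Lemma mem_true A X : In A X -> mem A X = true.
Proof. apply mem_In. Qed.

Lemma sublists_incl S X Y acc :
  In Y (sublists S X acc) -> In Y acc \/ incl Y (X ++ S).
Proof.
  revert X acc; induction S as [|A S IH]; simpl; intros X acc H.
  - rewrite app_nil_r. intuition (subst; auto using incl_refl).
  - destruct (IH _ _ H) as [H'|H'].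
    + destruct (IH _ _ H') as [|H'']; auto. right.
      intros B HB. specialize (H'' B HB). rewrite in_app_iff in *. simpl. tauto.
    + right. intros B HB. specialize (H' B HB). simpl in H'.
      rewrite in_app_iff in *. simpl. tauto.
Qed.

(** Induction on the round: each witness needed by [X] is obtained as a prime theory with smaller
    deficit, so it was accepted one round earlier. *)
Lemma saturated_worlds S (HS : subclosed S) n X :
  In X (sublists S [] []) -> saturated S X -> deficit S X < n -> In X (worlds S n).
Proof.
  revert X; induction n as [|n IH]; intros X HX sat Hn; [lia|].
  assert (XS : incl X S).
  { destruct (sublists_incl _ _ _ _ HX); [contradiction|assumption]. }
  assert (hyp : forall A, In A X -> der (fun B => In B X) A) by (intros; now apply der_hyp).
  assert (IH' : forall Y B, In Y (sublists S [] []) -> saturated S Y -> incl X Y ->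
            In B S -> In B Y -> ~ In B X -> In Y (worlds S n)).
  { intros Y B HY satY XY BS BY BX. apply IH; auto.
    assert (L := deficit_lt S X Y B XY BS BY BX). lia. }
  apply worlds_spec; split; auto. intros A AS. assert (I := HS _ AS).
  destruct A as [|p|B C|B C|B C|B]; simpl in I |- *.
  - apply Bool.negb_true_iff, mem_false. intros H. apply (sat_consistent _ _ sat); auto.
  - reflexivity.
  - assert (BS : In B S) by (apply I; simpl; auto).
    assert (CS : In C S) by (apply I; simpl; auto).
    destruct (mem (And B C) X) eqn:E.
    + apply mem_In, hyp in E.
      rewrite !mem_true; auto; apply (sat_closed _ _ sat); auto;
        (eapply der_mp; [|exact E]); apply der_ipl; constructor.
    + destruct (mem B X) eqn:EB; auto. destruct (mem C X) eqn:EC; auto.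
      apply mem_false in E. apply mem_In, hyp in EB. apply mem_In, hyp in EC.
      destruct E. apply (sat_closed _ _ sat); auto.
      eapply der_mp; [|exact EC]. eapply der_mp; [|exact EB].
      apply der_ipl; constructor.
  - assert (BS : In B S) by (apply I; simpl; auto).
    assert (CS : In C S) by (apply I; simpl; auto).
    destruct (mem (Or B C) X) eqn:E.
    + apply mem_In, (sat_prime _ _ sat) in E; auto.
      destruct (mem B X) eqn:EB; auto. apply mem_false in EB.
      apply mem_In. tauto.
    + apply mem_false in E.
      destruct (mem B X) eqn:EB; [|destruct (mem C X) eqn:EC; auto];
        destruct E; apply (sat_closed _ _ sat); auto.
      * apply mem_In, hyp in EB. eapply der_mp; [|exact EB]. apply der_ipl; constructor.
      * apply mem_In, hyp in EC. eapply der_mp; [|exact EC]. apply der_ipl; constructor.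
  - assert (BS : In B S) by (apply I; simpl; auto).
    assert (CS : In C S) by (apply I; simpl; auto).
    destruct (mem (Imp B C) X) eqn:E.
    + destruct (mem B X) eqn:EB; auto. apply mem_In, hyp in E. apply mem_In, hyp in EB.
      apply mem_In, (sat_closed _ _ sat); auto. eapply der_mp; eauto.
    + apply mem_false in E.
      destruct (mem B X) eqn:EB.
      * destruct (mem C X) eqn:EC; auto. apply mem_In, hyp in EC.
        destruct E. apply (sat_closed _ _ sat); auto.
        eapply der_mp; [|exact EC]. apply der_ipl; constructor.
      * apply mem_false in EB.
        (* By the deduction theorem [X] with [B] does not derive [C]. The witness is strictly larger
           because it gains [B]. *)
        destruct (saturated_extension S (extend (fun A => In A X) B) C) as (Y & HY & satY & GY & CY).
        { intros A [->|HA]; auto. }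
        { intros H. apply E, (sat_closed _ _ sat); auto. now apply deduction. }
        assert (XY : incl X Y) by (intros A HA; apply GY; now right).
        assert (BY : In B Y) by (apply GY; now left).
        apply existsb_exists. exists Y; split; eauto.
        apply separates_spec. repeat split; auto. intros ? [].
  - assert (BS : In B S) by (apply I; simpl; auto).
    destruct (mem (Box B) X) eqn:E; auto. apply mem_false in E.
    set (G := fun A => In A X \/ In (Box A) X).
    destruct (saturated_extension S (extend G (Box B)) B) as (Y & HY & satY & GY & CY).
    { intros A [->|[HA|HA]]; auto. apply (HS _ (XS _ HA)). simpl; auto. }
    (* [der_loeb] discharges the assumption [Box B]. Boxing the remaining derivation of [B] needs
       the box of every member of [G]: for members of [X] by coreflection, for the others by
       membership in [X]. *)
    { intros H. apply E, (sat_closed _ _ sat); auto.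
      apply der_box with (G := G); [now apply der_loeb|].
      intros A [HA|HA]; auto using der_coreflection. }
    assert (XY : incl X Y) by (intros A HA; apply GY; right; now left).
    assert (BY : In (Box B) Y) by (apply GY; now left).
    apply existsb_exists. exists Y; split; eauto.
    apply separates_spec. repeat split; auto.
    intros A HA. apply GY; right; now right.
Qed.

(** Excluded middle enters only the correctness proof; [iSL_dec] itself is a computable function. *)
Theorem iSL_dec_correct A : iSL_dec A = true <-> iSL A.
Proof.
  unfold iSL_dec. set (S := subforms A []).
  assert (HS : subclosed S) by (apply subforms_closed; intros ? []).
  assert (AS : In A S) by apply subforms_self.
  rewrite forallb_forall. split.
  - intros H. apply NNPP. intros HA.
    destruct (saturated_extension S (fun _ => False) A) as (X & HX & sat & _ & AX).
    { intros ? []. } { intros H'. now apply HA, der_empty. }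
    apply AX, mem_In, H, saturated_worlds; auto.
    (* The deficit is at most [length S], hence below the number of rounds. *)
    unfold deficit. assert (L := filter_length_le (fun A => negb (mem A X)) S). lia.
  - intros H X HX. apply mem_In.
    assert (GX : good S X) by (eexists; exact HX).
    apply (truth S HS A (exist _ X GX)); auto.
    now apply iSL_sound.
Qed.

(** * The program *)

(** The empty list is coded by the false value [Leaf], so a conditional on a list tests whether it
    is nonempty. *)
Fixpoint list_tree {T} (f : T -> tree) (l : list T) : tree :=
  match l with
  | [] => Leaf
  | x :: l' => Node (f x) (list_tree f l')
  end.

Definition forms_tree : list form -> tree := list_tree form_tree.
Definition worlds_tree : list (list form) -> tree := list_tree forms_tree.

Definition etrue : expr := ENode ELeaf ELeaf.
Definition enot (e : expr) : expr := EIf e ELeaf etrue.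

(* Tuples of arguments are nested to the right. *)
Definition arg1 : expr := EFst EVar.
Definition rest1 : expr := ESnd EVar.
Definition arg2 : expr := EFst rest1.
Definition rest2 : expr := ESnd rest1.
Definition arg3 : expr := EFst rest2.
Definition rest3 : expr := ESnd rest2.
Definition arg4 : expr := EFst rest3.
Definition rest4 : expr := ESnd rest3.

Definition call2 (i : nat) (e1 e2 : expr) : expr := ECall i (ENode e1 e2).

(** The tag of a formula code is a unary numeral; the nested tests peel off its successors. *)
Definition ecase (e ebot eatom eand eor eimp ebox : expr) : expr :=
  let t := EFst e in
  EIf t
    (EIf (ESnd t)
      (EIf (ESnd (ESnd t))
        (EIf (ESnd (ESnd (ESnd t)))
          (EIf (ESnd (ESnd (ESnd (ESnd t)))) ebox eimp)
          eor)
        eand)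
      eatom)
    ebot.

Notation feqb := 1 (only parsing).
Notation fmem := 2 (only parsing).
Notation fsubset := 3 (only parsing).
Notation funbox := 4 (only parsing).
Notation fseparates := 5 (only parsing).
Notation fexists := 6 (only parsing).
Notation flocally_ok := 7 (only parsing).
Notation fall_ok := 8 (only parsing).
Notation ffilter := 9 (only parsing).
Notation fworlds := 10 (only parsing).
Notation fall_mem := 11 (only parsing).
Notation fsubforms := 12 (only parsing).
Notation fsublists := 13 (only parsing).

(** The list [S] with one extra cell in front serves as a unary counter for the [length S + 1]
    rounds. The [let] belongs to the metalanguage, so the program recomputes [S] at each
    occurrence. *)
Definition main_body : expr :=
  let S := call2 fsubforms EVar ELeaf in
  call2 fall_mem EVar
    (call2 fworlds (ENode ELeaf S)
      (ENode (call2 fsublists S (ENode ELeaf ELeaf)) S)).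

Definition eqb_body : expr :=
  EIf arg1
    (EIf rest1
      (EIf (call2 feqb (EFst arg1) (EFst rest1))
        (call2 feqb (ESnd arg1) (ESnd rest1)) ELeaf)
      ELeaf)
    (enot rest1).

Definition mem_body : expr :=
  EIf rest1
    (EIf (call2 feqb arg1 arg2) etrue (call2 fmem arg1 rest2))
    ELeaf.

Definition subset_body : expr :=
  EIf arg1
    (EIf (call2 fmem (EFst arg1) rest1) (call2 fsubset (ESnd arg1) rest1) ELeaf)
    etrue.

Definition unbox_body : expr :=
  let next := call2 funbox (ESnd arg1) rest1 in
  EIf arg1
    (ecase (EFst arg1) next next next next next
      (EIf (call2 fmem (ESnd (EFst arg1)) rest1) next ELeaf))
    etrue.

Definition separates_body : expr :=
  let X := arg2 in let Z := arg3 in let A := arg4 in let B := rest4 in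
  EIf (call2 fsubset X arg1)
    (EIf (call2 funbox Z arg1)
      (EIf (call2 fmem A arg1) (enot (call2 fmem B arg1)) ELeaf)
      ELeaf)
    ELeaf.

Definition exists_body : expr :=
  EIf arg1
    (EIf (call2 fseparates (EFst arg1) rest1) etrue
      (call2 fexists (ESnd arg1) rest1))
    ELeaf.

Definition locally_ok_body : expr :=
  let B := EFst (ESnd arg1) in let C := ESnd (ESnd arg1) in
  let X := arg2 in let G := rest2 in
  let ein e := call2 fmem e X in
  let esep Z B C := call2 fexists G (ENode X (ENode Z (ENode B C))) in
  ecase arg1
    (enot (ein arg1))
    etrue
    (EIf (ein arg1) (EIf (ein B) (ein C) ELeaf) (EIf (ein B) (enot (ein C)) etrue))
    (EIf (ein arg1) (EIf (ein B) etrue (ein C)) (EIf (ein B) ELeaf (enot (ein C))))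
    (EIf (ein arg1) (EIf (ein B) (ein C) etrue)
      (EIf (ein B) (enot (ein C)) (esep ELeaf B C)))
    (EIf (ein arg1) etrue (esep X arg1 (ESnd arg1))).

Definition all_ok_body : expr :=
  EIf arg1
    (EIf (call2 flocally_ok (EFst arg1) rest1) (call2 fall_ok (ESnd arg1) rest1) ELeaf)
    etrue.

Definition filter_body : expr :=
  let next := call2 ffilter (ESnd arg1) rest1 in
  EIf arg1
    (EIf (call2 fall_ok arg2 (ENode (EFst arg1) rest2)) (ENode (EFst arg1) next) next)
    ELeaf.

Definition worlds_body : expr :=
  EIf arg1
    (call2 ffilter arg2 (ENode rest2 (call2 fworlds (ESnd arg1) rest1)))
    ELeaf.

Definition all_mem_body : expr :=
  EIf rest1
    (EIf (call2 fmem arg1 arg2) (call2 fall_mem arg1 rest2) ELeaf)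
    etrue.

Definition subforms_body : expr :=
  let binary := call2 fsubforms (EFst (ESnd arg1))
                  (call2 fsubforms (ESnd (ESnd arg1)) rest1) in
  ENode arg1 (ecase arg1 rest1 rest1 binary binary binary
                (call2 fsubforms (ESnd arg1) rest1)).

Definition sublists_body : expr :=
  EIf arg1
    (call2 fsublists (ESnd arg1)
      (ENode (ENode (EFst arg1) arg2) (call2 fsublists (ESnd arg1) rest1)))
    rest1.

Definition iSL_program : program :=
  [main_body; eqb_body; mem_body; subset_body; unbox_body; separates_body;
   exists_body; locally_ok_body; all_ok_body; filter_body; worlds_body;
   all_mem_body; subforms_body; sublists_body].

(** * Tools for evaluating the program *)

Definition runs (i : nat) (x v : tree) : Prop :=
  exists body, nth_error iSL_program i = Some body /\ eval iSL_program x body v.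

Lemma eval_call2 x i e1 e2 v1 v2 v :
  eval iSL_program x e1 v1 -> eval iSL_program x e2 v2 -> runs i (Node v1 v2) v ->
  eval iSL_program x (call2 i e1 e2) v.
Proof. intros H1 H2 (body & N & E). eauto using eval_call, eval_node. Qed.

Lemma eval_if p x c e1 e2 w v :
  eval p x c w ->
  match w with Leaf => eval p x e2 v | Node _ _ => eval p x e1 v end ->
  eval p x (EIf c e1 e2) v.
Proof. destruct w; eauto using eval_if_true, eval_if_false. Qed.

Lemma eval_enot p x e b :
  eval p x e (bool_tree b) -> eval p x (enot e) (bool_tree (negb b)).
Proof.
  intros H. eapply eval_if; [exact H|]. destruct b; repeat constructor.
Qed.

(** Projections are reduced while the codes of subformulas stay folded, in the shape in which the
    hints are stated. *)
Ltac project :=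
  cbn [tree_fst tree_snd list_tree forms_tree worlds_tree];
  repeat match goal with
  | |- context [tree_fst (tree_snd (form_tree (And ?B ?C)))] =>
      change (tree_fst (tree_snd (form_tree (And B C)))) with (form_tree B)
  | |- context [tree_snd (tree_snd (form_tree (And ?B ?C)))] =>
      change (tree_snd (tree_snd (form_tree (And B C)))) with (form_tree C)
  | |- context [tree_fst (tree_snd (form_tree (Or ?B ?C)))] =>
      change (tree_fst (tree_snd (form_tree (Or B C)))) with (form_tree B)
  | |- context [tree_snd (tree_snd (form_tree (Or ?B ?C)))] =>
      change (tree_snd (tree_snd (form_tree (Or B C)))) with (form_tree C)
  | |- context [tree_fst (tree_snd (form_tree (Imp ?B ?C)))] =>
      change (tree_fst (tree_snd (form_tree (Imp B C)))) with (form_tree B)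
  | |- context [tree_snd (tree_snd (form_tree (Imp ?B ?C)))] =>
      change (tree_snd (tree_snd (form_tree (Imp B C)))) with (form_tree C)
  | |- context [tree_snd (form_tree (Box ?B))] =>
      change (tree_snd (form_tree (Box B))) with (form_tree B)
  end.

Lemma eval_eq p x e v w : eval p x e v -> v = w -> eval p x e w.
Proof. now intros H <-. Qed.

(* The value is found by unification, so [e] must be branch-free. *)
Create HintDb runs.
Ltac compute_value :=
  lazymatch goal with
  | |- eval _ _ EVar _ => apply eval_var
  | |- eval _ _ ELeaf _ => apply eval_leaf
  | |- eval _ _ (ENode _ _) _ => eapply eval_node; compute_value
  | |- eval _ _ (EFst _) _ => eapply eval_fst; compute_value
  | |- eval _ _ (ESnd _) _ => eapply eval_snd; compute_value
  | |- eval _ _ (enot _) _ => eapply eval_enot; compute_value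
  | |- eval _ _ (call2 _ _ _) _ =>
      eapply eval_call2; [compute_value|compute_value|project; solve [eauto with runs]]
  | |- eval _ _ ?e _ => let e' := eval red in e in change e with e'; compute_value
  end.

Ltac evaluate := eapply eval_eq; [compute_value|reflexivity].

(** Case analysis on the Boolean value of the test simplifies the program and its specification
    together. *)
Ltac branch :=
  eapply eval_if; [compute_value|];
  project;
  try match goal with |- context [match bool_tree ?b with Leaf => _ | Node _ _ => _ end] =>
    destruct b; cbn [bool_tree andb orb] end.

Ltac run :=
  eexists; split; [reflexivity|];
  match goal with |- eval _ _ ?e _ => let e' := eval red in e in change e with e' end;
  cbv zeta.

Lemma eval_ecase x e e0 e1 e2 e3 e4 e5 A v :
  eval iSL_program x e (form_tree A) ->
  eval iSL_program x
    match A with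
    | Bot => e0 | Atom _ => e1 | And _ _ => e2 | Or _ _ => e3 | Imp _ _ => e4 | Box _ => e5
    end v ->
  eval iSL_program x (ecase e e0 e1 e2 e3 e4 e5) v.
Proof.
  intros H Hv. unfold ecase.
  destruct A;
    repeat (eapply eval_if; [repeat (eapply eval_snd || eapply eval_fst); exact H|];
            cbn [form_tree nat_tree tree_fst tree_snd]);
    exact Hv.
Qed.

(** * Correctness of the individual functions *)

Lemma runs_eqb s t : runs feqb (Node s t) (bool_tree (tree_eqb s t)).
Proof.
  revert t; induction s as [|a IHa b IHb]; intros [|c d]; run; branch; try branch;
    try (repeat constructor; fail).
  cbn [tree_eqb]. branch; evaluate.
Qed.
#[local] Hint Resolve runs_eqb : runs.

Lemma runs_mem A X :
  runs fmem (Node (form_tree A) (forms_tree X)) (bool_tree (mem A X)).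
Proof.
  unfold mem; induction X as [|B X IH]; run; branch; cbn [existsb]; [evaluate|].
  branch; evaluate.
Qed.
#[local] Hint Resolve runs_mem : runs.

Lemma runs_subset X Y :
  runs fsubset (Node (forms_tree X) (forms_tree Y)) (bool_tree (subset X Y)).
Proof.
  unfold subset; induction X as [|A X IH]; run; branch; cbn [forallb]; [evaluate|].
  branch; evaluate.
Qed.
#[local] Hint Resolve runs_subset : runs.

Lemma runs_unbox X Y :
  runs funbox (Node (forms_tree X) (forms_tree Y)) (bool_tree (unbox_subset X Y)).
Proof.
  unfold unbox_subset; induction X as [|A X IH]; run; branch; cbn [forallb]; [evaluate|].
  apply eval_ecase with A; [evaluate|].
  destruct A; cbn [andb]; try evaluate. branch; evaluate.
Qed.
#[local] Hint Resolve runs_unbox : runs.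

Lemma runs_separates X Z A B Y :
  runs fseparates
    (Node (forms_tree Y)
      (Node (forms_tree X) (Node (forms_tree Z) (Node (form_tree A) (form_tree B)))))
    (bool_tree (separates X Z A B Y)).
Proof.
  unfold separates; run. do 3 (branch; [|evaluate]). evaluate.
Qed.
#[local] Hint Resolve runs_separates : runs.

Lemma runs_exists G X Z A B :
  runs fexists
    (Node (worlds_tree G)
      (Node (forms_tree X) (Node (forms_tree Z) (Node (form_tree A) (form_tree B)))))
    (bool_tree (existsb (separates X Z A B) G)).
Proof.
  induction G as [|Y G IH]; run; branch; cbn [existsb]; [evaluate|].
  branch; evaluate.
Qed.
#[local] Hint Resolve runs_exists : runs.

(** In the implication case the program passes a literal [Leaf], from which unification does not
    recover the empty list. *)
Lemma runs_exists_nil G X A B :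
  runs fexists
    (Node (worlds_tree G)
      (Node (forms_tree X) (Node Leaf (Node (form_tree A) (form_tree B)))))
    (bool_tree (existsb (separates X [] A B) G)).
Proof. exact (runs_exists G X [] A B). Qed.
#[local] Hint Resolve runs_exists_nil : runs.

Lemma runs_locally_ok A X G :
  runs flocally_ok (Node (form_tree A) (Node (forms_tree X) (worlds_tree G)))
    (bool_tree (locally_ok G X A)).
Proof.
  run. apply eval_ecase with A; [evaluate|].
  destruct A; cbn [locally_ok]; repeat branch; evaluate.
Qed.
#[local] Hint Resolve runs_locally_ok : runs.

Lemma runs_all_ok S X G :
  runs fall_ok (Node (forms_tree S) (Node (forms_tree X) (worlds_tree G)))
    (bool_tree (forallb (locally_ok G X) S)).
Proof.
  induction S as [|A S IH]; run; branch; cbn [forallb]; [evaluate|].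
  branch; evaluate.
Qed.
#[local] Hint Resolve runs_all_ok : runs.

Lemma runs_filter P S G :
  runs ffilter (Node (worlds_tree P) (Node (forms_tree S) (worlds_tree G)))
    (worlds_tree (filter (fun X => forallb (locally_ok G X) S) P)).
Proof.
  induction P as [|X P IH]; run; branch; cbn [filter]; [evaluate|].
  branch; evaluate.
Qed.
#[local] Hint Resolve runs_filter : runs.

(** Only the length of the counter matters; [t] is arbitrary because each recursive call exposes
    another formula as its first cell. *)
Lemma runs_worlds S (L : list form) t :
  runs fworlds
    (Node (Node t (forms_tree L)) (Node (worlds_tree (sublists S [] [])) (forms_tree S)))
    (worlds_tree (worlds S (Datatypes.S (length L)))).
Proof.
  revert t; induction L as [|A L IH]; intros t; run; branch; cbn [length worlds].
  (* The recursive call has the exhausted counter [Leaf], which the statement does not cover, so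
     round 0 is run by hand. *)
  - eapply eval_call2; [compute_value| |apply runs_filter].
    apply eval_node; [evaluate|].
    eapply eval_call2; [compute_value|compute_value|]. project.
    eexists; split; [reflexivity|]. branch. evaluate.
  - evaluate.
Qed.

Lemma runs_all_mem A G :
  runs fall_mem (Node (form_tree A) (worlds_tree G)) (bool_tree (forallb (mem A) G)).
Proof.
  induction G as [|X G IH]; run; branch; cbn [forallb]; [evaluate|].
  branch; evaluate.
Qed.

Lemma runs_subforms A L :
  runs fsubforms (Node (form_tree A) (forms_tree L)) (forms_tree (subforms A L)).
Proof.
  revert L; induction A; intros L; run;
    apply eval_node with (v1 := form_tree _); try evaluate;
    eapply eval_ecase; try evaluate.
Qed.

Lemma runs_sublists S X L :
  runs fsublists (Node (forms_tree S) (Node (forms_tree X) (worlds_tree L)))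
    (worlds_tree (sublists S X L)).
Proof.
  revert X L; induction S as [|A S IH]; intros X L; run; branch; cbn [sublists]; [evaluate|].
  (* The argument is the code of [A :: X] only up to conversion, so the instance is given
     explicitly. *)
  eapply eval_call2; [compute_value|compute_value|]. project. apply (IH (A :: X)).
Qed.

Lemma iSL_program_computes A :
  computes iSL_program (form_tree A) (bool_tree (iSL_dec A)).
Proof.
  eapply eval_call; [apply eval_var|reflexivity|]. unfold main_body, iSL_dec; cbv zeta.
  set (S := subforms A []).
  assert (HS : eval iSL_program (form_tree A) (call2 fsubforms EVar ELeaf) (forms_tree S)).
  { eapply eval_call2; [compute_value|compute_value|]. apply (runs_subforms A []). }
  eapply eval_call2; [compute_value| |apply runs_all_mem].
  eapply eval_call2; [| |apply (runs_worlds S S Leaf)].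
  - apply eval_node; [evaluate|exact HS].
  - apply eval_node; [|exact HS].
    eapply eval_call2; [exact HS|compute_value|]. apply (runs_sublists S [] []).
Qed.

Theorem corollary2 : decidable iSL.
Proof.
  exists iSL_program. intros A. exists (iSL_dec A).
  split; [apply iSL_program_computes|apply iSL_dec_correct].
Qed.
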